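(* Let $M=(E,r_M)$ be a $q$-matroid, let $E'\ge E$ be an $\mathbb{F}_q$-vector space with $\dim E'=\dim E+1$, and let $\mu$ be a modular cut selector of $M$. Define $r_\mu:\mathcal{L}(E')\to\mathbb{Z}_{\ge0}$ by, for all $X\in\mathcal{L}(E)$ and $e\in[E']_q\setminus[E]_q$, $$r_\mu(X)=r_M(X),\qquad r_\mu(X+e)=r_M(X)+\delta_{X,e},$$ where $\delta_{X,e}=0$ if $\mathrm{cl}_M(X)\in\mu(e)$ and $\delta_{X,e}=1$ otherwise. Then $N_\mu=(E',r_\mu)$ is a $q$-matroid whose restriction to $E$ is $M$, and it is the unique $q$-matroid on $E'$ with restriction $M$ to $E$ such that for all $e\in[E']_q\setminus[E]_q$, $$\{F\in\mathcal{F}_M : F+e\in\mathcal{F}_{N_\mu}\text{ and } r_\mu(F+e)=r_\mu(F)\}=\mu(e).$$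
   Context: $q$ is a prime power. For a finite-dimensional $\mathbb{F}_q$-vector space $E$, $\mathcal{L}(E)$ is the set of subspaces and $[E]_q$ the set of one-dimensional subspaces. A $q$-matroid is a pair $(E,r)$ with $r:\mathcal{L}(E)\to\mathbb{Z}_{\ge0}$ satisfying (R1) $0\le r(X)\le\dim X$; (R2) $X\le Y\Rightarrow r(X)\le r(Y)$; (R3) $r(X+Y)+r(X\cap Y)\le r(X)+r(Y)$. The restriction of $(E',r)$ to $E\le E'$ is $(E,r|_{\mathcal{L}(E)})$. The closure operator is $\mathrm{cl}_M(X)=\sum\{x\in[E]_q : r(X+x)=r(X)\}$. A flat is a subspace $F$ with $r(F+x)>r(F)$ for all $x\in[E]_q\setminus[F]_q$; $\mathcal{F}_M$ is the set of flats. A pair $(F_1,F_2)$ of flats is modular if $r(F_1+F_2)+r(F_1\cap F_2)=r(F_1)+r(F_2)$. A modular cut of $M$ is $\mathcal{M}\subseteq\mathcal{F}_M$ with (M1) upward closure within $\mathcal{F}_M$ and (M2) $F_1,F_2\in\mathcal{M}$ modular pair $\Rightarrow F_1\cap F_2\in\mathcal{M}$; $\mathrm{MC}_M$ is the set of modular cuts. A modular cut selector of $M$ (with respect to $E'$) is a function $\mu:[E']_q\setminus[E]_q\to\mathrm{MC}_M$ such that (QM) for all $e_1,e_2\in[E']_q\setminus[E]_q$ and $F\in\mu(e_1)$: $F+e_1=F+e_2$ if and only if $F\in\mu(e_2)$. *)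

(* Defs.v *)
From HB Require Import structures.
From mathcomp Require Import all_boot all_algebra.

Set Implicit Arguments.
Unset Strict Implicit.
Unset Printing Implicit Defensive.

Section FiniteVspace.
Import VectorInternalTheory.
Variables (F : finFieldType) (V : vectType F).

(* {vspace V} is a subtype of a type of matrices over F, hence finite. *)
HB.instance Definition _ := [Finite of {vspace V} by <:].

End FiniteVspace.

Section QMatroid.

(* All spaces are subspaces of an ambient space V. A q-matroid on E is given by
   a function r on {vspace V}, of which only the values on the subspaces of E
   are meaningful. *)
Variables (F : finFieldType) (V : vectType F).
Local Notation vs := {vspace V}.
Implicit Types (E X Y U x e : vs) (C : {set vs}) (mu : vs -> {set vs}).
Implicit Types r : vs -> nat.

(* [E]_q *)
Definition points E : {set vs} :=
  [set x : vs | (\dim x == 1%N) && (x <= E)%VS].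

Definition is_qmatroid E r : Prop :=
  [/\ forall X, (X <= E)%VS -> r X <= \dim X,
      forall X Y, (X <= Y)%VS -> (Y <= E)%VS -> r X <= r Y
    & forall X Y, (X <= E)%VS -> (Y <= E)%VS ->
        r (X + Y)%VS + r (X :&: Y)%VS <= r X + r Y].

(* (E, rE) is the restriction to E of a q-matroid with rank function r. *)
Definition is_restriction E r (rE : vs -> nat) : Prop :=
  forall X, (X <= E)%VS -> r X = rE X.

Definition cl E r X : vs :=
  (\sum_(x in points E | r (X + x)%VS == r X) x)%VS.

Definition flats E r : {set vs} :=
  [set U : vs | (U <= E)%VS &&
    [forall x in points E :\: points U, r U < r (U + x)%VS]].

Definition modular_pair r X Y : Prop :=
  r (X + Y)%VS + r (X :&: Y)%VS = r X + r Y.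

Definition is_modular_cut E r C : Prop :=
  [/\ C \subset flats E r,
      forall X Y, X \in C -> Y \in flats E r -> (X <= Y)%VS -> Y \in C
    & forall X Y, X \in C -> Y \in C -> modular_pair r X Y ->
        (X :&: Y)%VS \in C].

(* Only the values of mu on [E']_q \ [E]_q matter. *)
Definition is_modular_cut_selector E r (E' : vs) mu : Prop :=
  (forall e, e \in points E' :\: points E -> is_modular_cut E r (mu e)) /\
  (forall e1 e2 U,
     e1 \in points E' :\: points E -> e2 \in points E' :\: points E ->
     U \in mu e1 -> ((U + e1)%VS = (U + e2)%VS <-> U \in mu e2)).

(* The defining equations of r_mu. A subspace of E' not contained in E is of
   the form X + e for several e, so their consistency is not automatic. *)
Definition is_extension_rank E r (E' : vs) mu (rmu : vs -> nat) : Prop :=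
  (forall X, (X <= E)%VS -> rmu X = r X) /\
  (forall X e, (X <= E)%VS -> e \in points E' :\: points E ->
     rmu (X + e)%VS = r X + (if cl E r X \in mu e then 0 else 1)).

(* The flats U of (E, r) such that U + e is a flat of (E', r') of the same
   rank as U. *)
Definition extension_cut E r (E' : vs) (r' : vs -> nat) e : {set vs} :=
  [set U in flats E r |
    ((U + e)%VS \in flats E' r') && (r' (U + e)%VS == r' U)].

End QMatroid.

(* Main.v *)
(* A subspace Y of E' not contained in E is (Y :&: E) + e for any point e of Y
   outside E; call [cl (Y :&: E) \notin mu e] its defect. (QM) makes the defect
   independent of e, (M1) makes it decrease as Y grows, and submodularity of
   r_mu reduces to two cases with defects 0: if X and Y share a point e outside
   E, (M2) applies to the closures of X :&: E and Y :&: E; otherwise (QM) does.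
   For uniqueness, if a q-matroid N extending M has N-rank of X + e equal to
   r X, then cl X + e is an N-flat of the same rank, so cl X lies in the cut
   of e. *)
Require Import Defs.
From mathcomp Require Import all_boot all_algebra.
From mathcomp Require Import zify.

Set Implicit Arguments.
Unset Strict Implicit.
Unset Printing Implicit Defensive.

(** * Points, and the traces of subspaces on a hyperplane *)

Section Points.
Variables (F : finFieldType) (V : vectType F).
Implicit Types (E X Y x e : {vspace V}).

Lemma in_points E x : (x \in points E) = (\dim x == 1) && (x <= E)%VS.
Proof. by rewrite inE. Qed.

Lemma in_pointsD E E' e :
  (e \in points E' :\: points E) =
    [&& \dim e == 1, (e <= E')%VS & ~~ (e <= E)%VS].
Proof. by rewrite !inE; case: (_ == 1) => //=; rewrite andbC. Qed.

Lemma pointsD_exists E X : ~~ (X <= E)%VS ->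
  exists2 e, e \in points X :\: points E & (e <= X)%VS.
Proof.
move=> /subvPn[v vX vE]; exists <[v]>%VS; last by rewrite -memvE.
rewrite in_pointsD -!memvE vX vE dim_vline !andbT.
by have [v0|//] := eqVneq v 0%R; rewrite v0 mem0v in vE.
Qed.

(** Containments are tested on points because [cl] and [flats] range over points only. *)
Lemma points_subv E X Y :
  (X <= E)%VS -> (forall x, x \in points E -> (x <= X)%VS -> (x <= Y)%VS) ->
  (X <= Y)%VS.
Proof.
move=> sXE sXY; apply: contraT => /pointsD_exists[e].
rewrite in_pointsD => /and3P[de _ /negP neY] seX; case: neY.
by apply: sXY => //; rewrite in_points de (subv_trans seX).
Qed.

Lemma pointsD_capv E E' e : e \in points E' :\: points E -> (e :&: E = 0)%VS.
Proof.
rewrite in_pointsD => /and3P[/eqP de _ neE]; apply/eqP.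
rewrite -dimv_eq0; apply: contraR neE => d0.
have /eqP <- : (e :&: E == e)%VS; last exact: capvSr.
by rewrite -(dimv_leqif_eq (capvSl e E)) eqn_leq dimvS ?capvSl // de lt0n.
Qed.

Lemma cap_add_point E E' X e :
  (X <= E)%VS -> e \in points E' :\: points E -> ((X + e) :&: E = X)%VS.
Proof.
by move=> sXE eD; rewrite -vspace_modl // (pointsD_capv eD) addv0.
Qed.

Lemma add_point_full E E' e :
  (E <= E')%VS -> \dim E' = (\dim E + 1)%N -> e \in points E' :\: points E ->
  (E + e = E')%VS.
Proof.
move=> sEE' dE' eD; apply/eqP; have e0 := pointsD_capv eD.
move: eD; rewrite in_pointsD => /and3P[/eqP de seE' _].
have sE : (E + e <= E')%VS by rewrite subv_add sEE'.
by rewrite -(dimv_leqif_eq sE) dimv_disjoint_sum ?de ?dE' // capvC.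
Qed.

(** By the modular law the left side is [Y :&: (E + e)], and [E + e] is all of [E'] because [E] is a
    hyperplane. *)
Lemma cap_hyperplaneK E E' Y e :
  (E <= E')%VS -> \dim E' = (\dim E + 1)%N -> e \in points E' :\: points E ->
  (e <= Y)%VS -> (Y <= E')%VS -> ((Y :&: E) + e = Y)%VS.
Proof.
move=> sEE' dE' eD seY sYE'.
by rewrite vspace_modr // (add_point_full sEE' dE' eD); apply/capv_idPl.
Qed.

End Points.

(** * Closure and flats of a q-matroid *)

Section QMatroidTheory.
Variables (F : finFieldType) (V : vectType F) (E : {vspace V}).
Variables (r : {vspace V} -> nat) (M_qmatroid : is_qmatroid E r).
Implicit Types (X Y Z U x : {vspace V}).

Lemma rank_le_dim X : (X <= E)%VS -> r X <= \dim X.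
Proof. by case: M_qmatroid => R1 _ _; apply: R1. Qed.

Lemma rank_mono X Y : (X <= Y)%VS -> (Y <= E)%VS -> r X <= r Y.
Proof. by case: M_qmatroid => _ R2 _; apply: R2. Qed.

Lemma rank_submod X Y : (X <= E)%VS -> (Y <= E)%VS ->
  r (X + Y)%VS + r (X :&: Y)%VS <= r X + r Y.
Proof. by case: M_qmatroid => _ _ R3; apply: R3. Qed.

Lemma rank_add_point X x : (X <= E)%VS -> x \in points E ->
  r (X + x)%VS <= (r X).+1.
Proof.
move=> sXE; rewrite in_points => /andP[/eqP dx sxE].
have := rank_submod sXE sxE; have := rank_le_dim sxE; lia.
Qed.

(** Submodularity for [Y] and [X + Z]: their sum is [Y + Z] and their intersection contains [X]. *)
Lemma rank_add_eq X Y Z : (X <= Y)%VS -> (Y <= E)%VS -> (Z <= E)%VS ->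
  r (X + Z)%VS = r X -> r (Y + Z)%VS = r Y.
Proof.
move=> sXY sYE sZE rXZ; have sXE := subv_trans sXY sYE.
have sXZE : (X + Z <= E)%VS by rewrite subv_add sXE.
have := rank_submod sYE sXZE.
rewrite addvA (addv_idPl sXY).
have /rank_mono : (X <= Y :&: (X + Z))%VS by rewrite subv_cap sXY addvSl.
move=> /(_ (subv_trans (capvSl _ _) sYE)).
have /rank_mono : (Y <= Y + Z)%VS by rewrite addvSl.
rewrite subv_add sYE sZE => /(_ isT); lia.
Qed.

Lemma cl_subE X : (cl E r X <= E)%VS.
Proof. by apply/subv_sumP => x; rewrite in_points => /andP[/andP[]]. Qed.

(** The points of the closure are added one at a time; [rank_add_eq] carries the equation of each
    point over to the partial sum. *)
Lemma rank_add_cl X : (X <= E)%VS -> r (X + cl E r X)%VS = r X.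
Proof.
move=> sXE; rewrite /cl.
suff [] : (\sum_(x in points E | r (X + x)%VS == r X) x <= E)%VS /\
   r (X + \sum_(x in points E | r (X + x)%VS == r X) x)%VS = r X by [].
elim/big_rec: _ => [|x S]; first by rewrite sub0v addv0.
rewrite in_points => /andP[/andP[_ sxE] /eqP rXx] [sSE rXS].
rewrite subv_add sxE sSE (addvC x) addvA.
by rewrite (rank_add_eq _ _ sxE rXx) ?addvSl // subv_add sXE.
Qed.

Lemma sub_clE X Y : (X <= E)%VS -> (Y <= E)%VS ->
  (Y <= cl E r X)%VS = (r (X + Y)%VS == r X).
Proof.
move=> sXE sYE; apply/idP/eqP => [sYcl | rXY].
  apply/eqP; rewrite eqn_leq [r X <= _]rank_mono ?addvSl ?subv_add ?sXE //.
  rewrite andbT.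
  rewrite -(rank_add_cl sXE) rank_mono ?addvS //.
  by rewrite subv_add sXE cl_subE.
apply: (points_subv sYE) => x xE sxY; apply: sumv_sup (subvv x) => //.
rewrite xE eqn_leq [r X <= _]rank_mono ?addvSl //= ?andbT; last first.
  by rewrite subv_add sXE (subv_trans sxY).
by rewrite -rXY rank_mono ?addvS // subv_add sXE.
Qed.

Lemma sub_cl X : (X <= E)%VS -> (X <= cl E r X)%VS.
Proof. by move=> sXE; rewrite sub_clE // addvv. Qed.

Lemma rank_cl X : (X <= E)%VS -> r (cl E r X) = r X.
Proof.
by move=> sXE; rewrite -[RHS]rank_add_cl // (addv_idPr (sub_cl sXE)).
Qed.

Lemma cl_mono X Y : (X <= Y)%VS -> (Y <= E)%VS -> (cl E r X <= cl E r Y)%VS.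
Proof.
move=> sXY sYE; have sXE := subv_trans sXY sYE.
rewrite sub_clE ?cl_subE //; apply/eqP.
by apply: rank_add_eq (rank_add_cl sXE); rewrite ?cl_subE.
Qed.

(** [cl E r Y] contains [X] and has the same rank, so it lies in [cl E r X]. *)
Lemma eq_cl X Y : (X <= Y)%VS -> (Y <= E)%VS -> r Y <= r X ->
  cl E r X = cl E r Y.
Proof.
move=> sXY sYE rYX; have sXE := subv_trans sXY sYE.
apply/eqP; rewrite eqEsubv cl_mono //= sub_clE ?cl_subE //.
have sXcl : (X <= cl E r Y)%VS by rewrite (subv_trans sXY) ?sub_cl.
by rewrite (addv_idPr sXcl) rank_cl // eqn_leq rYX rank_mono.
Qed.

(** Flats as the maximal subspaces of their rank: testing against arbitrary [Z] avoids arguing on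
    points later. *)
Lemma flatP U : reflect
  ((U <= E)%VS /\ forall Z, (Z <= E)%VS -> (U <= Z)%VS -> r Z <= r U ->
     (Z <= U)%VS)
  (U \in flats E r).
Proof.
rewrite inE; apply: (iffP andP) => -[sUE flU]; split=> //.
  move=> Z sZE sUZ rZU; apply: (points_subv sZE) => x xE sxZ.
  apply: contraLR rZU => nxU; rewrite -ltnNge.
  have xD : x \in points E :\: points U.
    by move: xE; rewrite in_pointsD in_points nxU andbT.
  apply: leq_trans (implyP (forallP flU x) xD) _.
  by rewrite rank_mono // subv_add sUZ.
apply/forallP => x; apply/implyP; rewrite in_pointsD => /and3P[_ sxE nxU].
rewrite ltnNge; apply: contra nxU => /(flU (U + x)%VS).
rewrite subv_add sUE sxE addvSl => /(_ isT isT).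
by rewrite subv_add => /andP[].
Qed.

Lemma cl_flat X : (X <= E)%VS -> cl E r X \in flats E r.
Proof.
move=> sXE; apply/flatP; split=> [|Z sZE sclZ rZ]; first exact: cl_subE.
have sXZ := subv_trans (sub_cl sXE) sclZ.
by rewrite (@eq_cl X Z) ?sub_cl // -(rank_cl sXE).
Qed.

Lemma flat_cl U : U \in flats E r -> cl E r U = U.
Proof.
case/flatP=> sUE flU; apply/eqP; rewrite eqEsubv sub_cl // andbT.
by apply: flU; rewrite ?cl_subE ?sub_cl ?rank_cl.
Qed.

(** Lets (M2), which concerns flats, be applied to arbitrary subspaces. Closures keep [r X] and
    [r Y] and can only raise the ranks of the sum and the intersection, so submodularity forces
    equality throughout. *)
Lemma cl_modular_pair X Y : (X <= E)%VS -> (Y <= E)%VS -> modular_pair r X Y ->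
  modular_pair r (cl E r X) (cl E r Y) /\
  cl E r (X :&: Y)%VS = cl E r (cl E r X :&: cl E r Y)%VS.
Proof.
rewrite /modular_pair => sXE sYE mXY.
have sI : (X :&: Y <= cl E r X :&: cl E r Y)%VS by rewrite capvS ?sub_cl.
have sS : (X + Y <= cl E r X + cl E r Y)%VS by rewrite addvS ?sub_cl.
have sIE : (cl E r X :&: cl E r Y <= E)%VS.
  by rewrite (subv_trans (capvSl _ _)) ?cl_subE.
have sSE : (cl E r X + cl E r Y <= E)%VS by rewrite subv_add !cl_subE.
have := rank_submod (cl_subE X) (cl_subE Y).
have := rank_mono sI sIE; have := rank_mono sS sSE.
rewrite !rank_cl // => rS rI rM; split; first by lia.
by apply: eq_cl => //; lia.
Qed.

End QMatroidTheory.

(** * Extensions of a q-matroid by one dimension *)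

Section Extension.
Variables (F : finFieldType) (V : vectType F) (E E' : {vspace V}).
Variables (r : {vspace V} -> nat) (M_qmatroid : is_qmatroid E r).
Hypotheses (sEE' : (E <= E')%VS) (dimE' : \dim E' = (\dim E + 1)%N).
Implicit Types (X Y Z U e : {vspace V}).

Lemma hyperplane_split Y : (Y <= E')%VS -> ~~ (Y <= E)%VS ->
  exists e, [/\ e \in points E' :\: points E, (e <= Y)%VS &
                ((Y :&: E) + e = Y)%VS].
Proof.
move=> sYE' /pointsD_exists[e eD seY].
have eD' : e \in points E' :\: points E.
  by move: eD; rewrite !in_pointsD => /and3P[-> _ ->]; rewrite (subv_trans seY).
by exists e; split=> //; apply: cap_hyperplaneK eD' _ _.
Qed.

(** A [Z] above [U + e] of no larger rank is [(Z :&: E) + e], and the flat [U] absorbs [Z :&: E],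
    whose rank is at most [r U]. *)
Lemma flat_add_point r' U e :
  is_qmatroid E' r' -> is_restriction E r' r -> U \in flats E r ->
  e \in points E' :\: points E -> r' (U + e)%VS = r U ->
  (U + e)%VS \in flats E' r'.
Proof.
move=> N_qmatroid resN /(flatP M_qmatroid)[sUE flU] eD rUe.
have := eD; rewrite in_pointsD => /and3P[_ seE' _].
apply/(flatP N_qmatroid); split; first by rewrite subv_add (subv_trans sUE).
move=> Z sZE'; rewrite subv_add => /andP[sUZ seZ] rZ.
rewrite -(cap_hyperplaneK sEE' dimE' eD seZ sZE') addvS //.
apply: flU; rewrite ?capvSr ?subv_cap ?sUZ // -rUe -resN ?capvSr //.
by apply: leq_trans rZ; apply: (rank_mono N_qmatroid) => //; apply: capvSl.
Qed.

(** * Closures and the modular cut selector *)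

Section Cut.
Variable mu : {vspace V} -> {set {vspace V}}.
Hypothesis mu_selector : is_modular_cut_selector E r E' mu.

Lemma cl_selector_mono X Y e : e \in points E' :\: points E ->
  (X <= Y)%VS -> (Y <= E)%VS -> cl E r X \in mu e -> cl E r Y \in mu e.
Proof.
move=> eD sXY sYE Xmu; case: mu_selector => /(_ e eD)[_ M1 _] _.
by apply: M1 Xmu _ _; [apply: cl_flat | apply: cl_mono].
Qed.

Lemma cl_selector_cap X Y e : e \in points E' :\: points E ->
  (X <= E)%VS -> (Y <= E)%VS -> cl E r X \in mu e -> cl E r Y \in mu e ->
  modular_pair r X Y -> cl E r (X :&: Y)%VS \in mu e.
Proof.
move=> eD sXE sYE Xmu Ymu /(cl_modular_pair M_qmatroid sXE sYE)[mXY ->].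
case: mu_selector => /(_ e eD)[/subsetP fl _ M2] _.
by have I := M2 _ _ Xmu Ymu mXY; rewrite (flat_cl M_qmatroid) ?fl.
Qed.

(** Adding [cl E r X] to both sides moves the equation to a flat, where (QM) applies. This is the
    consistency of the equations defining [rmu]. *)
Lemma cl_selector_congr X e1 e2 :
  e1 \in points E' :\: points E -> e2 \in points E' :\: points E ->
  (X <= E)%VS -> (X + e1 = X + e2)%VS ->
  (cl E r X \in mu e1) = (cl E r X \in mu e2).
Proof.
move=> e1D e2D sXE eqX; have [_ QM] := mu_selector.
have eqcl : (cl E r X + e1 = cl E r X + e2)%VS.
  by rewrite -(addv_idPl (sub_cl M_qmatroid sXE)) -!addvA eqX.
by apply/idP/idP => Xmu; apply/(QM _ _ _ _ _ Xmu).
Qed.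

Lemma extension_rank_exists :
  exists rmu : {vspace V} -> nat, is_extension_rank E r E' mu rmu.
Proof.
(* The default [0] arises only when [Y] has no point in [E'] outside [E], which never happens for
   [Y = X + e]. *)
pose pt Y := odflt 0%VS [pick e in points E' :\: points E | (e <= Y)%VS].
exists (fun Y => if (Y <= E)%VS then r Y else
  r (Y :&: E)%VS + if cl E r (Y :&: E)%VS \in mu (pt Y) then 0 else 1).
split=> [X -> // | X e sXE eD].
have := eD; rewrite in_pointsD => /and3P[_ seE' /negbTE neE].
rewrite subv_add sXE neE /= (cap_add_point sXE eD) /pt.
case: pickP => [e' /andP[e'D se'] | /(_ e)]; last by rewrite eD addvSr.
rewrite (@cl_selector_congr X e' e) //=.
have sXeE' : (X + e <= E')%VS by rewrite subv_add seE' (subv_trans sXE).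
have := cap_hyperplaneK sEE' dimE' e'D se' sXeE'.
by rewrite (cap_add_point sXE eD).
Qed.

(** * The extended rank function *)

Section Rank.
Variable rmu : {vspace V} -> nat.
Hypothesis rmu_ext : is_extension_rank E r E' mu rmu.

Lemma extension_rankE X : (X <= E)%VS -> rmu X = r X.
Proof. by case: rmu_ext => + _; apply. Qed.

Lemma extension_rank_point X e : (X <= E)%VS -> e \in points E' :\: points E ->
  rmu (X + e)%VS = r X + (cl E r X \notin mu e).
Proof. by case: rmu_ext => _ + sXE eD => -> //; case: ifP. Qed.

Lemma extension_rank_split Y e : (Y <= E')%VS ->
  e \in points E' :\: points E -> (e <= Y)%VS ->
  rmu Y = r (Y :&: E)%VS + (cl E r (Y :&: E) \notin mu e).
Proof.
move=> sYE' eD seY.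
by rewrite -extension_rank_point ?capvSr // (cap_hyperplaneK sEE' dimE' eD).
Qed.

Lemma extension_rank_le_dim X : (X <= E')%VS -> rmu X <= \dim X.
Proof.
move=> sXE'; have [sXE | nXE] := boolP (X <= E)%VS.
  by rewrite extension_rankE // (rank_le_dim M_qmatroid).
have [e [eD seX eqX]] := hyperplane_split sXE' nXE.
rewrite (extension_rank_split sXE' eD seX) -[in leqRHS]eqX.
rewrite dimv_disjoint_sum; last first.
  by rewrite -capvA [(E :&: e)%VS]capvC (pointsD_capv eD) capv0.
move: eD; rewrite in_pointsD => /and3P[/eqP -> _ _].
by rewrite leq_add ?(rank_le_dim M_qmatroid) ?capvSr // leq_b1.
Qed.

(** When both spaces leave [E], a drop of the defect is paid for by a growth of the rank of the
    trace on [E]: traces of equal rank have equal closures, hence equal defects. *)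
Lemma extension_rank_mono X Y : (X <= Y)%VS -> (Y <= E')%VS ->
  rmu X <= rmu Y.
Proof.
move=> sXY sYE'; have sXE' := subv_trans sXY sYE'.
have [sYE | nYE] := boolP (Y <= E)%VS.
  by rewrite !extension_rankE ?(rank_mono M_qmatroid) // (subv_trans sXY).
have [sXE | nXE] := boolP (X <= E)%VS.
  have [e [eD seY _]] := hyperplane_split sYE' nYE.
  rewrite extension_rankE // (extension_rank_split sYE' eD seY).
  by rewrite (leq_trans _ (leq_addr _ _)) // (rank_mono M_qmatroid)
    ?subv_cap ?sXY ?capvSr.
have [e [eD seX _]] := hyperplane_split sXE' nXE.
have seY := subv_trans seX sXY.
rewrite (extension_rank_split sXE' eD seX) (extension_rank_split sYE' eD seY).
have s0 : (X :&: E <= Y :&: E)%VS by rewrite capvS.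
have := rank_mono M_qmatroid s0 (capvSr _ _).
(* [clear] because lia case-splits on the boolean hypotheses of the context. *)
rewrite leq_eqVlt => /orP[/eqP r0 | ]; last by clear; lia.
by rewrite (eq_cl M_qmatroid s0) ?capvSr ?r0.
Qed.

(** If [X] leaves [E], the only defects are those of [X + Y] and [X], and (M1) bounds the first by
    the second. *)
Lemma extension_rank_submod_hyperplane X Y : (X <= E')%VS -> (Y <= E)%VS ->
  rmu (X + Y)%VS + rmu (X :&: Y)%VS <= rmu X + rmu Y.
Proof.
move=> sXE' sYE; have [sXE | nXE] := boolP (X <= E)%VS.
  rewrite !extension_rankE ?(rank_submod M_qmatroid) //.
    exact: subv_trans (capvSr _ _) _.
  by rewrite subv_add sXE.
have [e [eD seX eqX]] := hyperplane_split sXE' nXE.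
have s0 : ((X :&: E) + Y <= E)%VS by rewrite subv_add capvSr.
have -> : (X + Y = (X :&: E + Y) + e)%VS by rewrite -addvA (addvC Y) addvA eqX.
have -> : (X :&: Y = (X :&: E) :&: Y)%VS by rewrite -capvA (capv_idPr sYE).
rewrite extension_rank_point // (extension_rank_split sXE' eD seX).
rewrite !extension_rankE //; last exact: subv_trans (capvSr _ _) _.
have := rank_submod M_qmatroid (capvSr X E) sYE.
have := @cl_selector_mono _ _ e eD (addvSl (X :&: E) Y)%VS s0.
by clear; case: (cl E r (X :&: E) \in mu e) => [-> // |_] /=; lia.
Qed.

(** All four spaces contain [e], so all four defects are measured by the single cut [mu e]. *)
Lemma extension_rank_submod_common X Y e : (X <= E')%VS -> (Y <= E')%VS ->
  e \in points E' :\: points E -> (e <= X)%VS -> (e <= Y)%VS ->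
  rmu (X + Y)%VS + rmu (X :&: Y)%VS <= rmu X + rmu Y.
Proof.
move=> sXE' sYE' eD seX seY.
have eqX := cap_hyperplaneK sEE' dimE' eD seX sXE'.
have eqY := cap_hyperplaneK sEE' dimE' eD seY sYE'.
have [sX0 sY0] := (capvSr X E, capvSr Y E).
have s0 : ((X :&: E) + (Y :&: E) <= E)%VS by rewrite subv_add sX0.
have -> : (X + Y = (X :&: E + Y :&: E) + e)%VS.
  by rewrite -{1}eqX -{1}eqY (Monoid.mulmACA addv) /= addvv.
have sI : (X :&: Y <= E')%VS by apply: subv_trans (capvSl _ _) _.
have seI : (e <= X :&: Y)%VS by rewrite subv_cap seX.
rewrite extension_rank_point // (extension_rank_split sI eD seI).
have -> : ((X :&: Y) :&: E = (X :&: E) :&: (Y :&: E))%VS.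
  by rewrite (Monoid.mulmACA capv) /= capvv.
rewrite (extension_rank_split sXE' eD seX) (extension_rank_split sYE' eD seY).
have := rank_submod M_qmatroid sX0 sY0.
have := @cl_selector_mono _ _ e eD (addvSl (X :&: E) (Y :&: E))%VS s0.
have := @cl_selector_mono _ _ e eD (addvSr (X :&: E) (Y :&: E))%VS s0.
have := @cl_selector_cap _ _ e eD sX0 sY0; rewrite /modular_pair.
clear; case: (cl E r (X :&: E) \in mu e);
  case: (cl E r (Y :&: E) \in mu e) => /=.
- move=> /(_ isT isT) cut /(_ isT) -> _ /=.
  (* Only the intersection can have defect 1. Either the traces form a modular pair and (M2)
     excludes this, or strict submodularity pays for it. *)
  rewrite leq_eqVlt => /orP[/eqP req | ltr].
    by rewrite (cut req) !addn0 req.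
  by rewrite !addn0 addnA (leq_trans _ ltr) // -addn1 leq_add2l leq_b1.
- by move=> _ _ /(_ isT) -> /=; lia.
- by move=> _ /(_ isT) -> _ /=; lia.
by move=> _ _ _; lia.
Qed.

(* Here (X + Y) :&: E is larger than (X :&: E) + (Y :&: E) by one dimension.
   When both spaces have defect 0, the closure of the latter lies in mu e1 and
   mu e2, and (QM) makes it absorb that dimension. *)
Lemma extension_rank_submod_disjoint X Y : (X <= E')%VS -> (Y <= E')%VS ->
  ~~ (X <= E)%VS -> ~~ (Y <= E)%VS -> (X :&: Y <= E)%VS ->
  rmu (X + Y)%VS + rmu (X :&: Y)%VS <= rmu X + rmu Y.
Proof.
move=> sXE' sYE' nXE nYE sIE.
have [e1 [e1D se1 eqX]] := hyperplane_split sXE' nXE.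
have [e2 [e2D se2 eqY]] := hyperplane_split sYE' nYE.
have [sX0 sY0] := (capvSr X E, capvSr Y E).
have sSE' : (X + Y <= E')%VS by rewrite subv_add sXE'.
have se1S := subv_trans se1 (addvSl X Y).
have se2S := subv_trans se2 (addvSr X Y).
set Z := ((X + Y) :&: E)%VS; set S := (X :&: E + Y :&: E)%VS.
have sZE : (Z <= E)%VS := capvSr _ _.
have sXZ : (X :&: E <= Z)%VS by rewrite capvS ?addvSl.
have sYZ : (Y :&: E <= Z)%VS by rewrite capvS ?addvSr.
have sSE : (S <= E)%VS by rewrite subv_add sX0.
have sXS : (X :&: E <= S)%VS := addvSl _ _.
have sYS : (Y :&: E <= S)%VS := addvSr _ _.
have eqS : (X + Y = S + e1 + e2)%VS.
  by rewrite -{1}eqX -{1}eqY (Monoid.mulmACA addv) /= addvA.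
have sSZ : (S <= Z)%VS by rewrite subv_add sXZ.
(* [Z] is a hyperplane of [X + Y], which is [S] plus two points, so [Z] is either [S] or [S + z] for
   one point [z]. *)
have rZ1 : r Z <= (r S).+1.
  have [sZS | /pointsD_exists[z zD szZ]] := boolP (Z <= S)%VS.
    by apply: leqW; apply: (rank_mono M_qmatroid).
  have zE : z \in points E.
    move: zD; rewrite in_pointsD in_points => /and3P[-> _ _].
    exact: subv_trans sZE.
  apply: leq_trans (rank_add_point M_qmatroid sSE zE).
  have -> : (S + z = Z)%VS; last by [].
  have := zD; rewrite in_pointsD => /and3P[/eqP dz _ nzS].
  have zS0 : (S :&: z = 0)%VS by rewrite capvC; apply: pointsD_capv zD.
  have sSz : (S + z <= Z)%VS by rewrite subv_add sSZ.
  apply/eqP; rewrite -(dimv_leqif_eq sSz) eqn_leq dimvS //=.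
  rewrite dimv_disjoint_sum // dz.
  have Ze0 : (Z :&: e1 = 0)%VS.
    by rewrite -capvA [(E :&: e1)%VS]capvC (pointsD_capv e1D) capv0.
  have := dimv_disjoint_sum Ze0.
  rewrite (cap_hyperplaneK sEE' dimE' e1D se1S sSE') eqS.
  have := dimv_add_leqif (S + e1)%VS e2; have := dimv_add_leqif S e1.
  move: e1D e2D; rewrite !in_pointsD => /and3P[/eqP -> _ _] /and3P[/eqP -> _ _].
  by by move=> [+ _] [+ _]; clear; lia.
have eqI : (X :&: Y = (X :&: E) :&: (Y :&: E))%VS.
  by rewrite (Monoid.mulmACA capv) /= capvv (capv_idPl sIE).
rewrite [rmu (X :&: Y)%VS]extension_rankE // eqI.
rewrite (extension_rank_split sSE' e1D se1S) -/Z.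
rewrite (extension_rank_split sXE' e1D se1) (extension_rank_split sYE' e2D se2).
have := rank_submod M_qmatroid sX0 sY0; rewrite -/S => rS.
(* [X] is measured at [e1] and [Y] at [e2]; [X + Y] contains both points, so its defect can be
   compared with either. *)
have eqZ : (cl E r Z \in mu e1) = (cl E r Z \in mu e2).
  apply: cl_selector_congr => //.
  by rewrite !(cap_hyperplaneK sEE' dimE').
(* A defect 1 of [X] or [Y] pays for the possible extra unit of [r Z]; with both equal to 1, the
   second also pays for the defect of [X + Y]. *)
have [Xmu | _] := boolP (cl E r (X :&: E) \in mu e1); last first.
  have [Ymu | _] := boolP (cl E r (Y :&: E) \in mu e2); last first.
    by move: rS rZ1; clear; lia.
  by rewrite eqZ (cl_selector_mono e2D sYZ sZE Ymu); move: rS rZ1; clear; lia.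
rewrite (cl_selector_mono e1D sXZ sZE Xmu) /=.
have [Ymu | _] := boolP (cl E r (Y :&: E) \in mu e2); last first.
  by move: rS rZ1; clear; lia.
have S1 := cl_selector_mono e1D sXS sSE Xmu.
have S2 := cl_selector_mono e2D sYS sSE Ymu.
have /(_ S2) eqcl := (mu_selector.2 e1 e2 _ e1D e2D S1).2.
have sScl := sub_cl M_qmatroid sSE.
(* By (QM) [cl E r S + e1] contains [e2], hence [X + Y], and its trace on [E] is [cl E r S]. *)
have sZcl : (Z <= cl E r S)%VS.
  rewrite -[X in (_ <= X)%VS](cap_add_point (cl_subE E r S) e1D) capvS //.
  by rewrite eqS 2!subv_add addvSr eqcl addvSr (subv_trans sScl) ?addvSl.
have := rank_mono M_qmatroid sZcl (cl_subE E r S).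
by rewrite (rank_cl M_qmatroid sSE) /=; move: rS; clear; lia.
Qed.

Lemma extension_qmatroid : is_qmatroid E' rmu.
Proof.
split=> [|| X Y sXE' sYE'].
- exact: extension_rank_le_dim.
- exact: extension_rank_mono.
have [sYE | nYE] := boolP (Y <= E)%VS.
  exact: extension_rank_submod_hyperplane.
have [sXE | nXE] := boolP (X <= E)%VS.
  rewrite addvC capvC [leqRHS]addnC.
  exact: extension_rank_submod_hyperplane.
have [sIE | nIE] := boolP (X :&: Y <= E)%VS.
  exact: extension_rank_submod_disjoint.
have sIE' : (X :&: Y <= E')%VS by apply: subv_trans (capvSl _ _) _.
have [e [eD + _]] := hyperplane_split sIE' nIE.
rewrite subv_cap => /andP[seX seY].
exact: (extension_rank_submod_common sXE' sYE' eD).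
Qed.

(** A flat is its own closure, so the rank condition on [U] is exactly [U \in mu e]; flatness of
    [U + e] then follows from [flat_add_point]. *)
Lemma extension_cut_selector e : e \in points E' :\: points E ->
  extension_cut E r E' rmu e = mu e.
Proof.
move=> eD; case: mu_selector => /(_ e eD)[/subsetP flmu _ _] _.
apply/setP => U; rewrite in_set.
have [Ufl | nUfl] := boolP (U \in flats E r); last first.
  by rewrite (contraNF (flmu U) nUfl).
have [sUE _] := flatP M_qmatroid _ Ufl.
have rUe : (rmu (U + e)%VS == rmu U) = (U \in mu e).
  rewrite extension_rank_point // extension_rankE // (flat_cl M_qmatroid) //.
  by rewrite -[X in _ == X]addn0 eqn_add2l eqb0 negbK.
rewrite rUe; have [Umu | _] := boolP (U \in mu e); last by rewrite andbF.
rewrite andbT (flat_add_point extension_qmatroid extension_rankE) //.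
by apply/eqP; rewrite -(extension_rankE sUE) rUe.
Qed.

(** The value of [rN] at [X + e] is [r X] or [r X + 1], and the prescribed cut decides which. *)
Lemma extension_rank_unique rN :
  is_qmatroid E' rN -> is_restriction E rN r ->
  (forall e, e \in points E' :\: points E ->
     extension_cut E r E' rN e = mu e) ->
  forall X, (X <= E')%VS -> rN X = rmu X.
Proof.
move=> N_qmatroid resN cutN Y sYE'.
have [sYE | nYE] := boolP (Y <= E)%VS; first by rewrite resN // extension_rankE.
have [e [eD seY eqY]] := hyperplane_split sYE' nYE.
rewrite (extension_rank_split sYE' eD seY) -[in LHS]eqY.
set X := (Y :&: E)%VS; have sXE : (X <= E)%VS := capvSr _ _.
have sXE' := subv_trans sXE sEE'; have seE' := subv_trans seY sYE'.
have sXeE' : (X + e <= E')%VS by rewrite subv_add sXE'.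
have sclE' := subv_trans (cl_subE E r X) sEE'.
have sXcl := sub_cl M_qmatroid sXE.
have rcl : rN (cl E r X) = r X by rewrite resN ?cl_subE // (rank_cl M_qmatroid).
have le0 : r X <= rN (X + e)%VS.
  by rewrite -resN // (rank_mono N_qmatroid) ?addvSl.
have eE' : e \in points E'.
  by move: eD; rewrite in_pointsD in_points => /and3P[-> ->].
have le1 : rN (X + e)%VS <= (r X).+1.
  by rewrite -(resN _ sXE) (rank_add_point N_qmatroid).
have clflat := cl_flat M_qmatroid sXE.
have rle : rN (X + e)%VS <= rN (cl E r X + e)%VS.
  by rewrite (rank_mono N_qmatroid) ?addvS // subv_add sclE'.
apply/eqP; have [Xmu | nXmu] := boolP (cl E r X \in mu e).
  move: Xmu; rewrite -cutN // in_set => /and3P[_ _ /eqP]; rewrite rcl => eqcl.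
  by rewrite addn0 eqn_leq le0 -eqcl rle.
(* If [rN] did not grow from [X] to [X + e], it would not grow from [cl E r X] to [cl E r X + e]
   either, placing [cl E r X] in the cut of [e]. *)
rewrite addn1 eqn_leq le1 /= ltn_neqAle le0 andbT.
apply: contraNneq nXmu => /esym eqX.
have eqcl : rN (cl E r X + e)%VS = r X.
  rewrite -rcl; apply: (rank_add_eq N_qmatroid sXcl) => //.
  by rewrite eqX resN.
rewrite -cutN // in_set clflat eqcl rcl eqxx andbT.
by apply: flat_add_point; rewrite // eqcl (rank_cl M_qmatroid).
Qed.

End Rank.
End Cut.
End Extension.

Theorem theorem3p6 (F : finFieldType) (V : vectType F) (E E' : {vspace V})
    (rM : {vspace V} -> nat) (mu : {vspace V} -> {set {vspace V}})
    (M_qmatroid : is_qmatroid E rM)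
    (sEE' : (E <= E')%VS) (dimE' : \dim E' = (\dim E + 1)%N)
    (mu_selector : is_modular_cut_selector E rM E' mu) :
  (exists rmu : {vspace V} -> nat, is_extension_rank E rM E' mu rmu) /\
  (forall rmu : {vspace V} -> nat, is_extension_rank E rM E' mu rmu ->
    [/\ is_qmatroid E' rmu,
        is_restriction E rmu rM,
        forall e : {vspace V}, e \in points E' :\: points E ->
          extension_cut E rM E' rmu e = mu e
      & forall rN : {vspace V} -> nat,
          is_qmatroid E' rN ->
          is_restriction E rN rM ->
          (forall e : {vspace V}, e \in points E' :\: points E ->
             extension_cut E rM E' rN e = mu e) ->
          forall X : {vspace V}, (X <= E')%VS -> rN X = rmu X]).
Proof.
split; first exact: extension_rank_exists.
move=> rmu rmu_ext; split.
- exact: extension_qmatroid rmu_ext.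
- exact: (extension_rankE rmu_ext).
- by move=> e; apply: extension_cut_selector rmu_ext _.
- by move=> rN qN resN cutN; apply: extension_rank_unique rmu_ext _ _ _ _.
Qed.
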